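(* Let $\Lambda$ be a finite dimensional algebra over a field, let $k\ge1$ be an integer and let $0\to A\to B\to C\to0$ be a short exact sequence of finitely generated right $\Lambda$-modules with $k\text{-}\operatorname{ddell}A=m_1$ and $k\text{-}\operatorname{ddell}C=m_2$, where $m_1,m_2$ are nonnegative integers. Then $k\text{-}\operatorname{ddell}B\le m_1+m_2+1$.
   Context: $\mathrm{mod}\,\Lambda$ is the category of finitely generated right $\Lambda$-modules. $\mathbb N$ is the set of nonnegative integers; the infimum of the empty set is $+\infty$. $\Omega M$ is the kernel of a projective cover of $M$, $\Omega^0M=M$, $\Omega^{n+1}M=\Omega(\Omega^nM)$. ''$U$ is a direct summand of $V$ up to projective summands'' means that $U$ is isomorphic to a direct summand of $V\oplus P$ for some projective $P$. For an integer $j\ge1$, $j\text{-}\operatorname{dell}M$ is the infimum of all $n\in\mathbb N$ such that $\Omega^nM$ is a direct summand of $\Omega^{n+j}N$ up to projective summands for some $N\in\mathrm{mod}\,\Lambda$. $k\text{-}\operatorname{ddell}M$ is the infimum of all $m\in\mathbb N$ for which there exist $0\le n\le m$ and an exact sequence $0\to C_n\to\cdots\to C_1\to C_0\to M\to0$ in $\mathrm{mod}\,\Lambda$ with $(i+k)\text{-}\operatorname{dell}C_i\le m-i$ for $i=0,\dots,n$. *)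

(* Defs.v *)
From mathcomp Require Import all_boot all_algebra all_field.
From mathcomp Require Import boolp.

Set Implicit Arguments.
Unset Strict Implicit.
Unset Printing Implicit Defensive.

Import GRing.Theory.
Local Open Scope ring_scope.

(* [option nat] is the set of nonnegative integers extended with +oo = None. *)
Definition xnat_le (x y : option nat) : bool :=
  match x, y with
  | _, None => true
  | None, Some _ => false
  | Some a, Some b => (a <= b)%N
  end.

Lemma ex_asbool (P : nat -> Prop) : (exists n, P n) -> exists n, `[< P n >].
Proof. by move=> [n Pn]; exists n; apply/asboolP. Qed.

Definition xnat_inf (P : nat -> Prop) : option nat :=
  match pselect (exists n, P n) with
  | left exP => Some (ex_minn (ex_asbool exP))
  | right _ => None
  end.

(* Everything below is stated for left modules over a ring R. Right modules
   over L are the left modules over the converse ring L^c. *)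
Section Modules.
Variable R : pzRingType.

Definition fin_gen (M : lmodType R) : Prop :=
  exists s : seq M, forall x : M,
    exists c : 'I_(size s) -> R, x = \sum_(i < size s) c i *: s`_i.

Record fgMod : Type := FgMod {
  fgMod_sort :> lmodType R;
  fgModP : fin_gen fgMod_sort
}.

Definition surj (X Y : Type) (f : X -> Y) : Prop := forall y, exists x, f x = y.

Definition exact_at (X Y Z : lmodType R)
    (f : {linear X -> Y}) (g : {linear Y -> Z}) : Prop :=
  forall y, g y = 0 <-> exists x, f x = y.

Definition short_exact (X Y Z : lmodType R)
    (f : {linear X -> Y}) (g : {linear Y -> Z}) : Prop :=
  [/\ injective f, exact_at f g & surj g].

Definition mod_iso (X Y : lmodType R) : Prop :=
  exists f : {linear X -> Y}, bijective f.

Definition projective (P : lmodType R) : Prop :=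
  forall (X Y : lmodType R) (g : {linear X -> Y}) (f : {linear P -> Y}),
    surj g -> exists h : {linear P -> X}, forall x, g (h x) = f x.

Definition superfluous_ker (P M : lmodType R) (p : {linear P -> M}) : Prop :=
  forall L : {pred P}, submod_closed L ->
    (forall x, exists y z, [/\ p y = 0, z \in L & x = y + z]) ->
    forall x, x \in L.

Definition projective_cover (P M : lmodType R) (p : {linear P -> M}) : Prop :=
  [/\ projective P, surj p & superfluous_ker p].

Definition is_syzygy (M K : fgMod) : Prop :=
  exists (P : fgMod) (i : {linear K -> P}) (p : {linear P -> M}),
    projective_cover p /\ short_exact i p.

(* Syzygies are only defined up to isomorphism, so Omega^n M is the class of
   all X such that [is_Omega n M X]. *)
Fixpoint is_Omega (n : nat) (M X : fgMod) : Prop :=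
  match n with
  | 0 => mod_iso M X
  | n'.+1 => exists Y : fgMod, is_Omega n' M Y /\ is_syzygy Y X
  end.

Definition summand_up_to_proj (U V : fgMod) : Prop :=
  exists (P : fgMod) (W : lmodType R),
    projective P /\ mod_iso (V * P)%type (U * W)%type.

Definition dell (j : nat) (M : fgMod) : option nat :=
  xnat_inf (fun n => exists N X Y : fgMod,
    [/\ is_Omega n M X, is_Omega (n + j) N Y & summand_up_to_proj X Y]).

(* The exact sequence 0 -> C n -> ... -> C 0 -> M -> 0 is extended to the left
   by zero modules; exactness at C n then is injectivity of its outgoing map. *)
Definition finite_resolution (n : nat) (C : nat -> fgMod) (M : fgMod) : Prop :=
  (forall i, (n < i)%N -> forall x : C i, x = 0) /\
  exists (d : forall i, {linear C i.+1 -> C i}) (e : {linear C 0%N -> M}),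
    [/\ surj e, exact_at (d 0%N) e & forall i, exact_at (d i.+1) (d i)].

Definition ddell (k : nat) (M : fgMod) : option nat :=
  xnat_inf (fun m => exists (n : nat) (C : nat -> fgMod),
    [/\ (n <= m)%N, finite_resolution n C M
      & forall i, (i <= n)%N -> xnat_le (dell (i + k) (C i)) (Some (m - i)%N)]).

End Modules.

(* Main.v *)
Require Import Defs.
From HB Require Import structures.
From mathcomp Require Import all_boot all_algebra all_field.
From mathcomp Require Import boolp.

Set Implicit Arguments.
Unset Strict Implicit.
Unset Printing Implicit Defensive.

Import GRing.Theory.
Local Open Scope ring_scope.

(* Given resolutions A_0, ..., A_p of A and C_0, ..., C_q of C witnessing ddell, lift
   projective presentations P_i of Omega^i C through the first p+1 steps.  This
   resolves B by A_0 (+) P_0, ..., A_p (+) P_p followed by a resolution of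
   Omega^(p+1) C with terms Omega^(p+1) C_j (+) projective.  Projective summands
   do not affect dell, and passing from C_j to Omega^(p+1) C_j raises the index
   of dell by p+1 while keeping its bound, so the terms satisfy the required
   inequalities. *)

Section Submodules.
Variables (R : pzRingType) (V : lmodType R) (S : {pred V}).

Definition submod_pred of submod_closed S : {pred V} := S.

Variable S_closed : submod_closed S.

HB.instance Definition _ :=
  GRing.isSubmodClosed.Build R V (submod_pred S_closed)
    (GRing.submod_closed_semi S_closed).

Record submod := Submod {
  submod_val :> V;
  submod_valP : submod_val \in submod_pred S_closed
}.

HB.instance Definition _ := [isSub for submod_val].
HB.instance Definition _ := [Choice of submod by <:].
HB.instance Definition _ := [SubChoice_isSubLmodule of submod by <:].

Definition submod_incl : {linear submod -> V} := val.

End Submodules.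

Section LinearMaps.
Variable R : pzRingType.
Implicit Types X Y Z : lmodType R.

Definition lin X Y (f : X -> Y) (f_lin : linear f) : {linear X -> Y} :=
  HB.pack f (GRing.isLinear.Build R X Y *:%R f f_lin).

Lemma factor_inj X Y Z (i : {linear X -> Y}) (t : {linear Z -> Y}) :
  injective i -> (forall z, exists x, i x = t z) ->
  exists u : {linear Z -> X}, forall z, i (u z) = t z.
Proof.
move=> i_inj /choice[u iu].
have u_lin : linear u by move=> a x y; apply: i_inj; rewrite linearP !iu linearP.
by exists (lin u_lin).
Qed.

Lemma mod_iso_refl X : mod_iso X X.
Proof. by exists (idfun : {linear X -> X}); exists id. Qed.

Lemma ker_closed X Y (f : {linear X -> Y}) :
  submod_closed ([pred x | f x == 0] : {pred X}).
Proof.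
split=> [|a x y]; rewrite !inE ?linear0 // => /eqP fx /eqP fy.
by rewrite linearP fx fy scaler0 addr0.
Qed.

Definition kermod X Y (f : {linear X -> Y}) : lmodType R := submod (ker_closed f).

Definition ker_incl X Y (f : {linear X -> Y}) : {linear kermod f -> X} :=
  submod_incl (ker_closed f).

Lemma ker_incl_inj X Y (f : {linear X -> Y}) : injective (ker_incl f).
Proof. exact: val_inj. Qed.

Lemma ker_inclP X Y (f : {linear X -> Y}) : exact_at (ker_incl f) f.
Proof.
move=> x; split=> [fx|[[y fy] <-]]; last exact/eqP.
have fx' : x \in submod_pred (ker_closed f) by exact: (introT eqP fx).
by exists (Submod fx').
Qed.

Lemma pair_linear X Y Z (f : {linear X -> Y}) (g : {linear X -> Z}) :
  linear (fun x => (f x, g x)).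
Proof. by move=> a x y; rewrite !linearP. Qed.
Definition pair_lin X Y Z (f : {linear X -> Y}) (g : {linear X -> Z}) :
  {linear X -> (Y * Z)%type} := lin (pair_linear f g).

Lemma copair_linear X Y Z (f : {linear X -> Z}) (g : {linear Y -> Z}) :
  linear (fun x : (X * Y)%type => f x.1 + g x.2).
Proof. by move=> a x y; rewrite !linearP /= scalerDr addrACA. Qed.
Definition copair_lin X Y Z (f : {linear X -> Z}) (g : {linear Y -> Z}) :
  {linear (X * Y)%type -> Z} := lin (copair_linear f g).

Lemma fst_linear X Y : linear (fst : (X * Y)%type -> X). Proof. by []. Qed.
Definition fst_lin X Y : {linear (X * Y)%type -> X} := lin (@fst_linear X Y).
Lemma snd_linear X Y : linear (snd : (X * Y)%type -> Y). Proof. by []. Qed.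
Definition snd_lin X Y : {linear (X * Y)%type -> Y} := lin (@snd_linear X Y).

Definition sub_lin X Y (f g : {linear X -> Y}) : {linear X -> Y} := f \- g.
Definition zero_lin X Y : {linear X -> Y} := \0.

Definition inl_lin X Y : {linear X -> (X * Y)%type} := pair_lin idfun (zero_lin X Y).
Definition inr_lin X Y : {linear Y -> (X * Y)%type} := pair_lin (zero_lin Y X) idfun.

Lemma prod_projective X Y : projective X -> projective Y -> projective (X * Y)%type.
Proof.
move=> X_proj Y_proj A B g f g_surj.
have [h1 gh1] := X_proj _ _ g (f \o inl_lin X Y) g_surj.
have [h2 gh2] := Y_proj _ _ g (f \o inr_lin X Y) g_surj.
exists (copair_lin h1 h2) => -[x y] /=.
by rewrite linearD gh1 gh2 /= -linearD; congr (f (_, _)); rewrite ?addr0 ?add0r.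
Qed.

Lemma fin_genP X : fin_gen X <->
  exists (I : finType) (s : I -> X), forall x,
    exists c : I -> R, x = \sum_i c i *: s i.
Proof.
split=> [[s sP]|[I [s sP]]].
  by exists 'I_(size s), (fun i : 'I_(size s) => s`_i).
exists [seq s i | i <- enum I] => x; have [c ->] := sP x.
have sz : size [seq s i | i <- enum I] = #|I| by rewrite size_map -cardE.
exists (fun i => c (enum_val (cast_ord sz i))).
rewrite (reindex (fun i => enum_val (cast_ord sz i))) /=; last first.
  exists (fun i => cast_ord (esym sz) (enum_rank i)) => i _.
    by rewrite enum_valK cast_ordK.
  by rewrite cast_ordKV enum_rankK.
apply: eq_bigr => i _; congr (_ *: _).
have lt_i : (i < size (enum I))%N by rewrite -(size_map s).
rewrite (nth_map (enum_val (cast_ord sz i))) //.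
by congr (s _); rewrite /enum_val; apply: set_nth_default.
Qed.

Lemma fin_gen_surj X Y (f : {linear X -> Y}) : surj f -> fin_gen X -> fin_gen Y.
Proof.
move=> f_surj /fin_genP[I [s sP]]; apply/fin_genP; exists I, (f \o s) => y.
have [x <-] := f_surj y; have [c ->] := sP x; exists c.
by rewrite linear_sum; apply: eq_bigr => i _; rewrite linearZ.
Qed.

Lemma fin_gen_prod X Y : fin_gen X -> fin_gen Y -> fin_gen (X * Y)%type.
Proof.
move=> /fin_genP[I [s sP]] /fin_genP[J [t tP]]; apply/fin_genP.
exists (I + J)%type, (fun k => match k with inl i => (s i, 0) | inr j => (0, t j) end).
move=> [x y]; have [c ->] := sP x; have [d ->] := tP y.
exists (fun k => match k with inl i => c i | inr j => d j end).
rewrite big_sumType /=.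
rewrite (_ : \sum_(i : I) _ = inl_lin X Y (\sum_i c i *: s i)); last first.
  by rewrite linear_sum; apply: eq_bigr => i _; rewrite [RHS]linearZ.
rewrite (_ : \sum_(j : J) _ = inr_lin X Y (\sum_j d j *: t j)); last first.
  by rewrite linear_sum; apply: eq_bigr => j _; rewrite [RHS]linearZ.
by congr (_, _); rewrite /= ?addr0 ?add0r.
Qed.

Definition prod_fg (X Y : fgMod R) : fgMod R :=
  FgMod (fin_gen_prod (@fgModP R X) (@fgModP R Y)).

(* Up to the projective [P], the maps [s] and [r] exhibit [U] as a retract of
   [V]; unlike an isomorphism of direct sums, this form lifts directly to
   projective presentations. *)
Definition stable_retract (U V : lmodType R) : Prop :=
  exists (P : fgMod R) (s : {linear U -> V}) (r : {linear V -> U})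
    (a : {linear U -> P}) (b : {linear P -> U}),
    projective P /\ forall u, u = r (s u) + b (a u).

Definition presents (M K : lmodType R) : Prop :=
  exists (P : fgMod R) (i : {linear K -> P}) (p : {linear P -> M}),
    projective P /\ short_exact i p.

Lemma stable_retract_presents U V K L :
  stable_retract U V -> presents U K -> presents V L -> stable_retract K L.
Proof.
move=> [E [s [r [a [b [E_proj sr]]]]]].
move=> [P [i [p [P_proj [i_inj ip p_surj]]]]] [Q [j [q [Q_proj [j_inj jq q_surj]]]]].
have [s' qs'] := P_proj _ _ q (s \o p) q_surj.
have [r' pr'] := Q_proj _ _ p (r \o q) p_surj.
have [b' pb'] := E_proj _ _ p b p_surj.
have pi k : p (i k) = 0 by apply/ip; exists k.
have qj l : q (j l) = 0 by apply/jq; exists l.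
have [sK jsK] : exists sK : {linear K -> L}, forall k, j (sK k) = (s' \o i) k.
  by apply: factor_inj => // k; apply/jq; rewrite /= qs' /= pi linear0.
have [rL irL] : exists rL : {linear L -> K}, forall l, i (rL l) = (r' \o j) l.
  by apply: factor_inj => // l; apply/ip; rewrite /= pr' /= qj linear0.
pose d := sub_lin (sub_lin idfun (r' \o s')) (b' \o (a \o p)).
have [t it] : exists t : {linear P -> K}, forall x, i (t x) = d x.
  apply: factor_inj => // x; apply/ip; rewrite /d /= !linearB pr' /= qs' pb' /=.
  by rewrite [X in X - _ - _]sr addrAC addrK subrr.
exists P, sK, rL, i, t; split=> // k; apply: i_inj.
by rewrite linearD it irL /= jsK /d /= pi !linear0 addr0 addrC subrK.
Qed.

Lemma stable_retract_trans U V T :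
  stable_retract U V -> stable_retract V T -> stable_retract U T.
Proof.
move=> [P [s [r [a [b [P_proj sr]]]]]] [Q [s' [r' [a' [b' [Q_proj sr']]]]]].
exists (prod_fg P Q), (s' \o s), (r \o r'), (pair_lin a (a' \o s)),
  (copair_lin b (r \o b')); split; first exact: prod_projective.
move=> u; rewrite {1}[u]sr [s u in LHS]sr' /= linearD -addrA; congr (_ + _).
exact: addrC.
Qed.

Lemma summand_up_to_projP (U V : fgMod R) :
  summand_up_to_proj U V <-> stable_retract U V.
Proof.
split=> [[P [W [P_proj [f [h fK hK]]]]]|[P [s [r [a [b [P_proj sr]]]]]]].
  have h_lin : linear h.
    by move=> c x y; apply: (can_inj fK); rewrite linearP !hK.
  pose h' := lin h_lin.
  exists P, (fst_lin V P \o (h' \o inl_lin U W)), (fst_lin U W \o (f \o inl_lin V P)),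
    (snd_lin V P \o (h' \o inl_lin U W)), (fst_lin U W \o (f \o inr_lin V P)).
  split=> // u /=.
  rewrite -[_ + _]/((f (_, _) + f (_, _)).1) -linearD.
  rewrite (_ : (_, _) + (_, _) = h (u, 0)) ?hK //.
  by rewrite [RHS]surjective_pairing; congr (_, _); rewrite /= ?addr0 ?add0r.
pose g := copair_lin r b.
have gs u : g (s u, a u) = u by rewrite [RHS]sr.
exists P, (kermod g); split=> //.
have [w wE] : exists w : {linear (V * P)%type -> kermod g},
    forall x, ker_incl g (w x) = sub_lin idfun (pair_lin s a \o g) x.
  apply: factor_inj; first exact: ker_incl_inj.
  by move=> x; apply/(ker_inclP g); rewrite linearB; apply/eqP; rewrite subr_eq0; apply/eqP/esym/gs.
exists (pair_lin g w).
exists (fun x => pair_lin s a x.1 + ker_incl g x.2) => [x|[u k]] /=.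
  by rewrite -[LHS]/(pair_lin s a (g x) + ker_incl g (w x)) wE addrC subrK.
have gk : g (ker_incl g k) = 0 by apply/(ker_inclP g); exists k.
have gE : g ((s u, a u) + ker_incl g k) = u.
  by rewrite linearD gk addr0; apply: gs.
congr (_, _); first exact: gE.
apply: (@ker_incl_inj _ _ g); rewrite wE.
rewrite -[LHS]/(_ - pair_lin s a (g _)) gE addrC addKr //.
Qed.

End LinearMaps.

Lemma xnat_inf_leP (P : nat -> Prop) n :
  xnat_le (xnat_inf P) (Some n) <-> exists2 m, (m <= n)%N & P m.
Proof.
rewrite /xnat_inf; case: pselect => [exP|nexP] /=; last first.
  by split=> // -[m _ Pm]; case: nexP; exists m.
case: ex_minnP => m /asboolP Pm m_min; split=> [le_mn|[p le_pn Pp]].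
  by exists m.
by apply: leq_trans le_pn; apply: m_min; apply/asboolP.
Qed.

Section Resolutions.
Variable R : pzRingType.
Hypothesis fin_gen_ker : forall (X Y : lmodType R) (f : {linear X -> Y}),
  fin_gen X -> fin_gen (kermod f).
Hypothesis proj_cover_exists : forall M : fgMod R,
  exists (P : fgMod R) (p : {linear P -> M}), projective_cover p.

Definition ker_fg (X : fgMod R) (Y : lmodType R) (f : {linear X -> Y}) : fgMod R :=
  FgMod (fin_gen_ker f (@fgModP R X)).

Lemma proj_presentation (M : fgMod R) :
  exists (P : fgMod R) (p : {linear P -> M}), projective P /\ surj p.
Proof. by have [P [p [P_proj p_surj _]]] := proj_cover_exists M; exists P, p. Qed.

Lemma iso_stable_retract (U V : fgMod R) :
  mod_iso U V -> stable_retract U V /\ stable_retract V U.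
Proof.
move=> [f [h fK hK]].
have h_lin : linear h.
  by move=> c x y; apply: (can_inj fK); rewrite linearP !hK.
have [P [p [P_proj _]]] := proj_presentation U.
split.
  exists P, f, (lin h_lin), (zero_lin U P), (zero_lin P U).
  by split=> // u; rewrite /= fK addr0.
exists P, (lin h_lin), f, (zero_lin V P), (zero_lin P V).
by split=> // u; rewrite /= hK addr0.
Qed.

Lemma is_syzygy_presents (M K : fgMod R) : is_syzygy M K -> presents M K.
Proof. by move=> [P [i [p [[P_proj _ _] ipE]]]]; exists P, i, p. Qed.

Lemma syzygy_exists (M : fgMod R) : exists K : fgMod R, is_syzygy M K.
Proof.
have [P [p p_cover]] := proj_cover_exists M.
exists (ker_fg p), P, (ker_incl p), p; split=> //; case: p_cover => _ p_surj _.
by split=> //; [exact: ker_incl_inj|exact: ker_inclP].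
Qed.

Lemma Omega_exists n (M : fgMod R) : exists X : fgMod R, is_Omega n M X.
Proof.
elim: n => [|n [Y nY]]; first by exists M; exact: mod_iso_refl.
by have [X YX] := syzygy_exists Y; exists X, Y.
Qed.

Lemma Omega_stable_retract n (U V X Y : fgMod R) :
  is_Omega n U X -> is_Omega n V Y -> stable_retract U V -> stable_retract X Y.
Proof.
elim: n X Y => [|n IHn] X Y /=.
  move=> /iso_stable_retract[_ XU] /iso_stable_retract[VY _] UV.
  by apply: stable_retract_trans XU _; apply: stable_retract_trans UV _.
move=> [X' [UX' /is_syzygy_presents X'X]] [Y' [VY' /is_syzygy_presents Y'Y]] UV.
exact: stable_retract_presents (IHn _ _ UX' VY' UV) X'X Y'Y.
Qed.

Lemma Omega_presents n (M K X X' Y : fgMod R) : presents M K ->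
  is_Omega n K X' -> is_Omega n M X -> presents X Y -> stable_retract X' Y.
Proof.
elim: n X X' Y => [|n IHn] X X' Y MK /=.
  move=> /iso_stable_retract[_ X'K] /iso_stable_retract[MX _] XY.
  exact: stable_retract_trans X'K (stable_retract_presents MX MK XY).
move=> [Z' [KZ' /is_syzygy_presents Z'X']] [Z [MZ /is_syzygy_presents ZX]] XY.
exact: stable_retract_presents (IHn _ _ _ MK KZ' MZ ZX) Z'X' XY.
Qed.

Lemma dell_leP j n (M : fgMod R) : xnat_le (dell j M) (Some n) <->
  exists2 m, (m <= n)%N & exists N X Y : fgMod R,
    [/\ is_Omega m M X, is_Omega (m + j) N Y & stable_retract X Y].
Proof.
rewrite xnat_inf_leP; split=> -[m le_mn [N [X [Y [MX NY XY]]]]];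
  by exists m => //; exists N, X, Y; split=> //; apply/summand_up_to_projP.
Qed.

Lemma dell_stable_retract j n (M M' : fgMod R) : stable_retract M' M ->
  xnat_le (dell j M) (Some n) -> xnat_le (dell j M') (Some n).
Proof.
move=> M'M /dell_leP[m le_mn [N [X [Y [MX NY XY]]]]]; apply/dell_leP.
exists m => //; have [X' M'X'] := Omega_exists m M'; exists N, X', Y; split=> //.
by apply: stable_retract_trans XY; apply: Omega_stable_retract M'X' MX M'M.
Qed.

Lemma dell_presents j n (M K : fgMod R) : presents M K ->
  xnat_le (dell j M) (Some n) -> xnat_le (dell j.+1 K) (Some n).
Proof.
move=> MK /dell_leP[m le_mn [N [X [Y [MX NY XY]]]]]; apply/dell_leP.
exists m => //; have [X' KX'] := Omega_exists m K.
have [X1 /is_syzygy_presents XX1] := syzygy_exists X.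
have [Y1 YY1] := syzygy_exists Y.
exists N, X', Y1; split=> //; first by rewrite addnS; exists Y.
apply: stable_retract_trans (Omega_presents MK KX' MX XX1) _.
exact: stable_retract_presents XY XX1 (is_syzygy_presents YY1).
Qed.

Lemma dell_prod_proj j n (M P : fgMod R) : projective P ->
  xnat_le (dell j M) (Some n) -> xnat_le (dell j (prod_fg M P)) (Some n).
Proof.
move=> P_proj; apply: dell_stable_retract.
exists P, (fst_lin M P), (inl_lin M P), (snd_lin M P), (inr_lin M P); split=> //.
by move=> [x y]; congr (_, _); rewrite /= ?addr0 ?add0r.
Qed.

Lemma dell_le_trans j n n' (M : fgMod R) : (n <= n')%N ->
  xnat_le (dell j M) (Some n) -> xnat_le (dell j M) (Some n').
Proof. by case: (dell j M) => //= d le_nn' le_dn; apply: leq_trans le_nn'. Qed.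

(* [M] has a resolution with [l] terms [C_0], ..., [C_(l-1)] such that
   [(i+k)-dell C_i <= m - i]; the next module [K] is the kernel of [C_0 -> M]. *)
Fixpoint dell_resolution (l k m : nat) (M : fgMod R) : Prop :=
  match l with
  | 0 => forall x : M, x = 0
  | l'.+1 => exists (C0 K : fgMod R) (i : {linear K -> C0}) (e : {linear C0 -> M}),
      [/\ short_exact i e, xnat_le (dell k C0) (Some m)
        & dell_resolution l' k.+1 m.-1 K]
  end.

Lemma dell_resolution_le l k m m' (M : fgMod R) : (m <= m')%N ->
  dell_resolution l k m M -> dell_resolution l k m' M.
Proof.
elim: l k m m' M => [//|l IHl] k m m' M le_mm' [C0 [K [i [e [ie C0m Kres]]]]].
exists C0, K, i, e; split=> //; first exact: dell_le_trans C0m.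
by apply: IHl Kres; rewrite -!subn1 leq_sub2r.
Qed.

Lemma dell_resolution_iso l k m (M M' : fgMod R) (f : {linear M -> M'}) :
  injective f -> surj f -> dell_resolution l k m M -> dell_resolution l k m M'.
Proof.
move=> f_inj f_surj; case: l => [M0 y|l [C0 [K [i [e [[i_inj ie e_surj] C0m Kres]]]]]].
  by have [x <-] := f_surj y; rewrite (M0 x) linear0.
exists C0, K, i, (f \o e); split=> //; split=> // [y|y].
  by rewrite -ie; split=> [fey|ey0]; [apply: f_inj; rewrite linear0|rewrite /= ey0 linear0].
by have [x <-] := f_surj y; have [c <-] := e_surj x; exists c.
Qed.

Lemma dell_resolution_syzygy l k m (M : fgMod R) : dell_resolution l k m M ->
  exists K : fgMod R, presents M K /\ dell_resolution l k.+1 m K.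
Proof.
elim: l k m M => [|l IHl] k m M.
  move=> M0; exists M; split=> //; exists M, (zero_lin M M), idfun; split.
    move=> X Y g f _; exists (zero_lin M X) => x.
    by rewrite (M0 x) !linear0.
  split=> [x y _|y|y]; first by rewrite (M0 x) (M0 y).
    by split=> [_|_]; [exists y; rewrite (M0 y)|exact: M0].
  by exists y.
move=> [C0 [K [i [e [[i_inj ie e_surj] C0m /IHl[K' [KK' K'res]]]]]]].
case: KK' => [P [j [p [P_proj [j_inj jp p_surj]]]]].
have [Q [q [Q_proj q_surj]]] := proj_presentation M.
have [h eh] := Q_proj _ _ e q e_surj.
pose t : {linear prod_fg P Q -> C0} := copair_lin (i \o p) h.
have t_surj : surj t.
  move=> c; have [y qy] := q_surj (e c).
  have /ie[k' ik'] : e (c - h y) = 0 by rewrite linearB eh qy subrr.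
  have [x px] := p_surj k'; exists (x, y).
  by rewrite /t /= px ik' subrK.
pose L := ker_fg t; pose K1 := ker_fg q.
exists K1; split.
  exists Q, (ker_incl q), q; split=> //.
  by split=> //; [exact: ker_incl_inj|exact: ker_inclP].
have ei z : e (i z) = 0 by apply/ie; exists z.
have tL (z : L) : i (p (ker_incl t z).1) + h (ker_incl t z).2 = 0.
  by apply/(ker_inclP t); exists z.
have [s sE] : exists s : {linear L -> K1},
    forall z, ker_incl q (s z) = (snd_lin P Q \o ker_incl t) z.
  apply: factor_inj; first exact: ker_incl_inj.
  move=> z; apply/(ker_inclP q); rewrite /= -eh.
  by have := congr1 e (tL z); rewrite linearD ei add0r linear0.
have [j' j'E] : exists j' : {linear K' -> L},
    forall z, ker_incl t (j' z) = (inl_lin P Q \o j) z.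
  apply: factor_inj; first exact: ker_incl_inj.
  move=> z; apply/(ker_inclP t).
  have pj : p (j z) = 0 by apply/jp; exists z.
  by rewrite /t /= pj !linear0 addr0.
exists L, K', j', s; split=> //; last first.
  apply: dell_presents C0m.
  exists (prod_fg P Q), (ker_incl t), t; split; first exact: prod_projective.
  by split=> //; [exact: ker_incl_inj|exact: ker_inclP].
split.
- move=> x y /(congr1 (ker_incl t)); rewrite !j'E => /(congr1 fst) /=; exact: j_inj.
- move=> z; split=> [sz0|[x <-]]; last first.
    by apply: (@ker_incl_inj _ _ _ q); rewrite sE -[LHS]/(ker_incl t (j' x)).2 j'E linear0.
  have z2 : (ker_incl t z).2 = 0.
    by have := sE z; rewrite sz0 linear0.
  have /jp[x jx] : p (ker_incl t z).1 = 0.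
    by apply: i_inj; have := tL z; rewrite z2 !linear0 addr0.
  exists x; apply: (@ker_incl_inj _ _ _ t); rewrite j'E -[LHS]/(j x, 0) jx.
  by rewrite [RHS]surjective_pairing z2.
- move=> y.
  have /ie[k' ik'] : e (h (ker_incl q y)) = 0 by rewrite eh; apply/(ker_inclP q); exists y.
  have [x px] := p_surj (- k').
  have /(ker_inclP t)[z zE] : t (x, ker_incl q y) = 0.
    by rewrite /t /= px linearN ik' addNr.
  exists z; apply: (@ker_incl_inj _ _ _ q); by rewrite sE -[LHS]/(ker_incl t z).2 zE.
Qed.

Lemma finite_resolution_dell n k m (C : nat -> fgMod R) (M : fgMod R) :
  finite_resolution n C M ->
  (forall i, (i <= n)%N -> xnat_le (dell (i + k) (C i)) (Some (m - i)%N)) ->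
  dell_resolution n.+1 k m M.
Proof.
elim: n k m C M => [|n IHn] k m C M [C0 [d [e [e_surj de dd]]]] Cdell.
  exists (C 0%N), (C 1%N), (d 0%N), e; split.
  - by split=> // x y _; rewrite (C0 1%N isT x) (C0 1%N isT y).
  - by have := Cdell 0%N (leqnn _); rewrite subn0.
  - by move=> x; apply: C0.
have ed0 x : e (d 0%N x) = 0 by apply/de; exists x.
have [e' e'E] : exists e' : {linear C 1%N -> kermod e},
    forall x, ker_incl e (e' x) = d 0%N x.
  by apply: factor_inj; [exact: ker_incl_inj|move=> x; apply/(ker_inclP e)].
exists (C 0%N), (ker_fg e), (ker_incl e), e; split.
- by split=> //; [exact: ker_incl_inj|exact: ker_inclP].
- by have := Cdell 0%N (leq0n _); rewrite subn0.
apply: (IHn _ _ (C \o S)) => [|i le_in]; last first.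
  by have := Cdell i.+1 le_in; rewrite /= addSnnS -subn1 -subnDA add1n.
split=> [i lt_ni x|]; first exact: (C0 i.+1).
exists (fun i => d i.+1), e'; split=> [z|y|i]; last exact: dd.
  have /de[x dx] : e (ker_incl e z) = 0 by apply/(ker_inclP e); exists z.
  by exists x; apply: ker_incl_inj; rewrite e'E.
rewrite -(dd 0%N); split=> [e'y|dy]; first by rewrite -e'E e'y linear0.
by apply: (@ker_incl_inj _ _ _ e); rewrite e'E dy linear0.
Qed.

Lemma dell_finite_resolution l k m (M : fgMod R) : dell_resolution l k m M ->
  exists C : nat -> fgMod R,
    [/\ forall i, (l <= i)%N -> forall x : C i, x = 0,
        exists (d : forall i, {linear C i.+1 -> C i}) (e : {linear C 0%N -> M}),
          [/\ surj e, exact_at (d 0%N) e & forall i, exact_at (d i.+1) (d i)]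
      & forall i, (i < l)%N -> xnat_le (dell (i + k) (C i)) (Some (m - i)%N)].
Proof.
elim: l k m M => [|l IHl] k m M.
  move=> M0; exists (fun=> M); split=> //.
  exists (fun=> zero_lin M M), (zero_lin M M).
  have exM : exact_at (zero_lin M M) (zero_lin M M).
    by move=> x; split=> // _; exists x; rewrite [RHS]M0.
  by split=> // x; exists x; rewrite [RHS]M0.
move=> [C0 [K [i [e [[i_inj ie e_surj] C0m /IHl]]]]].
move=> [C [C0' [d [e' [e'_surj de' dd]]] Cdell]].
pose D j := if j is j'.+1 then C j' else C0.
exists D; split=> [[|j]|| [|j]] //=; first exact: C0'.
- exists (fun j => if j is j'.+1 return {linear D j.+1 -> D j} then d j' else i \o e'), e.
  split=> [//|y|[|j]]; last exact: dd.
    rewrite ie; split=> [[k' <-]|[x <-]]; last by exists (e' x).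
    by have [x <-] := e'_surj k'; exists x.
  move=> y /=; rewrite -de'; split=> [iey|->]; last exact: linear0.
  by apply: i_inj; rewrite linear0.
- by rewrite subn0.
- by move=> lt_jl; have := Cdell j lt_jl; rewrite addSnnS -subn1 -subnDA add1n.
Qed.

(* The first term of the resolution of [B] is [A_0 (+) P] for a projective
   presentation [P -> C]; its kernel is an extension of [Omega C] by the
   kernel of [A_0 -> A]. *)
Lemma dell_resolution_extension a c k m1 m2 m (A B C : fgMod R)
    (f : {linear A -> B}) (g : {linear B -> C}) :
  short_exact f g -> dell_resolution a k m1 A -> dell_resolution c k m2 C ->
  (m1 <= m)%N -> (m2 + a <= m)%N -> dell_resolution (a + c) k m B.
Proof.
elim: a k m1 m A B C f g => [|a IHa] k m1 m A B C f g [f_inj fg g_surj].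
  move=> A0 Cres _; rewrite addn0 => le_m2m.
  have g_inj : injective g.
    move=> x y gxy; apply/eqP; rewrite -subr_eq0; apply/eqP.
    have /fg[z <-] : g (x - y) = 0 by rewrite linearB gxy subrr.
    by rewrite (A0 z) linear0.
  have [h hE] : exists h : {linear C -> B}, forall z, g (h z) = (idfun : {linear C -> C}) z.
    by apply: factor_inj => // z; apply: g_surj.
  apply: (dell_resolution_iso (f := h)); last exact: dell_resolution_le Cres.
    by apply: can_inj hE.
  by move=> y; exists (g y); apply: g_inj; rewrite hE.
move=> [A0 [K [i [e [[i_inj ie e_surj] A0dell Kres]]]]].
move=> /dell_resolution_syzygy[C' [[P [j [p [P_proj [j_inj jp p_surj]]]]] C'res]].
move=> le_m1m le_m2m.
have [h gh] := P_proj _ _ g p g_surj.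
pose t : {linear prod_fg A0 P -> B} := copair_lin (f \o e) h.
have gf x : g (f x) = 0 by apply/fg; exists x.
have t_surj : surj t.
  move=> b; have [y py] := p_surj (g b).
  have /fg[x fx] : g (b - h y) = 0 by rewrite linearB gh py subrr.
  have [z ez] := e_surj x; exists (z, y).
  by rewrite -[LHS]/(f (e z) + h y) ez fx subrK.
pose L := ker_fg t.
have tL (z : L) : f (e (ker_incl t z).1) + h (ker_incl t z).2 = 0.
  by apply/(ker_inclP t); exists z.
exists (prod_fg A0 P), L, (ker_incl t), t; split.
- by split=> //; [exact: ker_incl_inj|exact: ker_inclP].
- by apply: dell_prod_proj => //; apply: dell_le_trans A0dell.
have [g' g'E] : exists g' : {linear L -> C'},
    forall z, j (g' z) = (snd_lin A0 P \o ker_incl t) z.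
  apply: factor_inj => // z; apply/jp; rewrite -gh.
  by have := congr1 g (tL z); rewrite linearD gf add0r linear0.
have [f' f'E] : exists f' : {linear K -> L},
    forall z, ker_incl t (f' z) = (inl_lin A0 P \o i) z.
  apply: factor_inj; first exact: ker_incl_inj.
  move=> z; apply/(ker_inclP t).
  have ei : e (i z) = 0 by apply/ie; exists z.
  by rewrite -[LHS]/(f (e (i z)) + h 0) ei !linear0 addr0.
apply: (IHa _ _ _ _ _ _ f' g') Kres C'res _ _; last 2 first.
- by rewrite -!subn1 leq_sub2r.
- by rewrite -ltnS (leq_trans _ (leqSpred m)) // -addnS.
split.
- move=> x y /(congr1 (ker_incl t)); rewrite !f'E => /(congr1 fst); exact: i_inj.
- move=> z; split=> [gz0|[x <-]]; last first.
    by apply: j_inj; rewrite g'E -[LHS]/(ker_incl t (f' x)).2 f'E linear0.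
  have z2 : (ker_incl t z).2 = 0.
    by have := g'E z; rewrite gz0 linear0.
  have /ie[x ix] : e (ker_incl t z).1 = 0.
    by apply: f_inj; have := tL z; rewrite z2 !linear0 addr0.
  exists x; apply: (@ker_incl_inj _ _ _ t); rewrite f'E -[LHS]/(i x, 0) ix.
  by rewrite [RHS]surjective_pairing z2.
- move=> y.
  have /fg[x fx] : g (h (j y)) = 0 by rewrite gh; apply/jp; exists y.
  have [z ez] := e_surj (- x).
  have /(ker_inclP t)[w wE] : t (z, j y) = 0.
    by rewrite -[LHS]/(f (e z) + h (j y)) ez linearN fx addNr.
  by exists w; apply: j_inj; rewrite g'E -[LHS]/(ker_incl t w).2 wE.
Qed.

Lemma ddell_extension k m1 m2 (A B C : fgMod R)
    (f : {linear A -> B}) (g : {linear B -> C}) : short_exact f g ->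
  xnat_le (ddell k A) (Some m1) -> xnat_le (ddell k C) (Some m2) ->
  xnat_le (ddell k B) (Some (m1 + m2 + 1)%N).
Proof.
move=> fg /xnat_inf_leP[a le_am1 [p [CA [le_pa CAres CAdell]]]].
move=> /xnat_inf_leP[c le_cm2 [q [CC [le_qc CCres CCdell]]]].
have Ares := finite_resolution_dell CAres CAdell.
have Cres := finite_resolution_dell CCres CCdell.
have le_am : (a <= a + c + 1)%N by rewrite -addnA leq_addr.
have le_cpm : (c + p.+1 <= a + c + 1)%N by rewrite addn1 addnS ltnS addnC leq_add2r.
have [D [D0 Dres Ddell]] :=
  dell_finite_resolution (dell_resolution_extension fg Ares Cres le_am le_cpm).
apply/xnat_inf_leP; exists (a + c + 1)%N; first by rewrite leq_add2r leq_add.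
exists (p + q.+1)%N, D; split.
- by rewrite addnS addn1 ltnS leq_add.
- by split=> // i; rewrite -addSn; apply: D0.
- by move=> i le_i; apply: Ddell; rewrite addSn ltnS.
Qed.

End Resolutions.

Section FinDimAlgebra.
Variables (F : fieldType) (Lambda : falgType F).

(* The two structures live on convertible types: [free_mod I] is the right
   [Lambda]-module [Lambda^I] and [free_vect I] its underlying [F]-space. *)
Definition free_mod (I : finType) : lmodType Lambda^c := {ffun I -> (Lambda^c)^o}.
Definition free_vect (I : finType) : vectType F := {ffun I -> Lambda}.

Lemma scale_free_vect (I : finType) (a : F) (v : free_mod I) :
  (a *: (v : free_vect I) : free_vect I) = (a%:A : Lambda^c) *: v.
Proof. by apply/ffunP => i; rewrite !ffunE -[RHS]/((v i : Lambda) * a%:A) mulr_algr. Qed.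

Lemma free_map_linear (I : finType) (X : lmodType Lambda^c) (s : I -> X) :
  linear (fun v : free_mod I => \sum_i (v i : Lambda^c) *: s i).
Proof.
move=> a u v; rewrite scaler_sumr -big_split; apply: eq_bigr => i _.
by rewrite !ffunE scalerDl scalerA.
Qed.

Definition free_map (I : finType) (X : lmodType Lambda^c) (s : I -> X) :
  {linear free_mod I -> X} := lin (free_map_linear s).

Lemma fin_gen_free_map (X : lmodType Lambda^c) : fin_gen X <->
  exists (I : finType) (s : I -> X), surj (free_map s).
Proof.
rewrite fin_genP; split=> -[I [s sP]]; exists I, s => x; have [c cx] := sP x.
  exists [ffun i => c i]; rewrite cx; apply: eq_bigr => i _.
  by rewrite ffunE.
by exists c; rewrite -cx.
Qed.

Lemma free_map_eq (I : finType) (Y : lmodType Lambda^c) (f : {linear free_mod I -> Y}) :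
  exists s : I -> Y, f =1 free_map s.
Proof.
pose d i : free_mod I := [ffun j => (j == i)%:R].
exists (f \o d) => v.
have {1}-> : v = \sum_i (v i : Lambda^c) *: d i.
  apply/ffunP => j; rewrite sum_ffunE (bigD1 j) //= big1 => [|i /negPf ne_ij].
    by rewrite !ffunE eqxx addr0 [RHS]mulr1.
  by rewrite !ffunE eq_sym ne_ij [LHS]mulr0.
by rewrite linear_sum; apply: eq_bigr => i _; rewrite linearZ.
Qed.

Lemma free_mod_projective (I : finType) : projective (free_mod I).
Proof.
move=> X Y g f g_surj; have [s fE] := free_map_eq f.
have [t gt] := choice (fun i => g_surj (s i)).
exists (free_map t) => v; rewrite fE linear_sum; apply: eq_bigr => i _.
by rewrite linearZ /= gt.
Qed.

Lemma submod_vspace (I : finType) (S : {pred free_mod I}) : submod_closed S ->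
  exists U : {vspace free_vect I}, forall v, (v \in U) = (v \in S).
Proof.
move=> [S0 Slin].
pose dims d := `[< exists U : {vspace free_vect I},
  (forall v, v \in U -> v \in S) /\ \dim U = d >].
have exd : exists d, dims d.
  by exists 0%N; apply/asboolP; exists 0%VS; rewrite dimv0; split=> // v /vlineP[a ->]; rewrite scaler0.
have dmax d : dims d -> (d <= dim (free_vect I))%N.
  by move=> /asboolP[U [_ <-]]; rewrite -dimvf dimvS ?subvf.
case: (ex_maxnP exd dmax) => d /asboolP[U [US dU]] d_max.
exists U => v; apply/idP/idP => [/US//|Sv].
have /d_max : dims (\dim (U + <[v]>)%VS).
  apply/asboolP; exists (U + <[v]>)%VS; split=> // w /memv_addP[u Uu [_ /vlineP[a ->] ->]].
  by rewrite scale_free_vect addrC; apply: Slin => //; apply: US.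
rewrite -dU (geq_leqif (dimv_leqif_sup (addvSl U <[v]>%VS))) subv_add subvv /=.
by rewrite -memvE.
Qed.

Lemma fin_gen_submod_free (I : finType) (S : {pred free_mod I})
  (S_closed : submod_closed S) : fin_gen (submod S_closed).
Proof.
have [U US] := submod_vspace S_closed.
apply/fin_genP; exists 'I_(\dim U).
have bS (i : 'I_(\dim U)) : ((vbasis U)`_i : free_mod I) \in submod_pred S_closed.
  have : (vbasis U)`_i \in U by rewrite vbasis_mem // mem_nth ?size_tuple.
  by rewrite US.
exists (fun i => Submod (bS i)) => x.
have xU : (submod_val x : free_vect I) \in U by rewrite US; exact: submod_valP.
exists (fun i => (coord (vbasis U) i (submod_val x))%:A); apply: val_inj.
rewrite [LHS](coord_vbasis xU) [RHS](linear_sum (submod_incl S_closed)).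
by apply: eq_bigr => i _; rewrite scale_free_vect linearZ.
Qed.

Lemma fin_gen_kermod (X Y : lmodType Lambda^c) (f : {linear X -> Y}) :
  fin_gen X -> fin_gen (kermod f).
Proof.
move=> /fin_gen_free_map[I [s s_surj]]; pose t : {linear _ -> _} := f \o free_map s.
have [h hE] : exists h : {linear kermod t -> kermod f},
    forall z, ker_incl f (h z) = (free_map s \o ker_incl t) z.
  apply: factor_inj; first exact: ker_incl_inj.
  by move=> z; apply/(ker_inclP f)/(ker_inclP t); exists z.
apply: (fin_gen_surj (f := h)); last exact: fin_gen_submod_free.
move=> y; have [x xE] := s_surj (ker_incl f y).
have /(ker_inclP t)[z zx] : t x = 0.
  by rewrite -[LHS]/(f (free_map s x)) xE; apply/(ker_inclP f); exists y.
by exists z; apply: (@ker_incl_inj _ _ _ f); rewrite hE -xE -zx.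
Qed.

Lemma submod_dim_le (I : finType) (S T : {pred free_mod I}) (U V : {vspace free_vect I}) :
  (forall v, (v \in U) = (v \in S)) -> (forall v, (v \in V) = (v \in T)) ->
  {subset S <= T} -> (\dim V <= \dim U)%N -> {subset T <= S}.
Proof.
move=> US VT ST le_VU v Tv.
have UV : (U <= V)%VS by apply/subvP => w; rewrite US VT; apply: ST.
by rewrite -US (eqP (_ : U == V)) ?VT // eqEdim UV.
Qed.

Lemma image_closed (R : pzRingType) (X Y : lmodType R) (f : {linear X -> Y}) :
  submod_closed ([pred y | `[< exists x, f x = y >]] : {pred Y}).
Proof.
split=> [|a u v]; rewrite !inE; first by apply/asboolP; exists 0; rewrite linear0.
move=> /asboolP[x <-] /asboolP[y <-]; apply/asboolP; exists (a *: x + y).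
by rewrite linearP.
Qed.

Lemma injective_on_image (I : finType) (h : {linear free_mod I -> free_mod I}) :
  (forall u, exists v, h u = h (h v)) -> forall u, h (h u) = 0 -> h u = 0.
Proof.
move=> h_surj u hhu.
have h_lin : linear (h : free_vect I -> free_vect I).
  by move=> a x y; rewrite scale_free_vect linearP scale_free_vect.
pose k : 'End(free_vect I) := linfun (lin h_lin).
have kE x : k x = h x by rewrite lfunE.
have kk : (k @: (k @: fullv) = k @: fullv)%VS.
  apply/eqP; rewrite eqEsubv limgS ?subvf //=; apply/subvP => _ /memv_imgP[x _ ->].
  by have [y] := h_surj x; rewrite -!kE => ->; rewrite !memv_img ?memvf.
have := limg_ker_dim k (k @: fullv); rewrite kk => /eqP.
rewrite -[X in _ == X]add0n eqn_add2r dimv_eq0 => /eqP ker0.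
have : k u \in (k @: fullv :&: lker k)%VS.
  by rewrite memv_cap memv_img ?memvf // memv_ker kE kE hhu eqxx.
by rewrite ker0 memv0 kE => /eqP.
Qed.

(* Among the endomorphisms [h] of [Lambda^I] with [pi h = pi], one of minimal
   rank restricts to an automorphism of its image, so that the image is a direct
   summand; a submodule of the image that still surjects onto [M] would yield
   such an endomorphism of smaller rank. *)
Lemma proj_cover_exists (M : fgMod Lambda^c) :
  exists (P : fgMod Lambda^c) (p : {linear P -> M}), projective_cover p.
Proof.
have /fin_gen_free_map[I [s s_surj]] := @fgModP _ M.
pose E := free_mod I; pose pi : {linear E -> M} := free_map s.
pose im (h : {linear E -> E}) : {pred E} := [pred y | `[< exists x, h x = y >]].
pose ranks d := `[< exists (h : {linear E -> E}) (U : {vspace free_vect I}),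
  [/\ forall v, pi (h v) = pi v, forall v, (v \in U) = (v \in im h) & \dim U = d] >].
have ex_rank : exists d, ranks d.
  have [U UE] := submod_vspace (image_closed (idfun : {linear E -> E})).
  by exists (\dim U); apply/asboolP; exists idfun, U.
case: (ex_minnP ex_rank) => _ /asboolP[h [U [pih UE <-]]] rank_min.
have min_im (k : {linear E -> E}) : (forall v, pi (k v) = pi v) ->
    (forall v, exists u, k v = h u) -> forall u, exists v, h u = k v.
  move=> pik kh u; have [V VE] := submod_vspace (image_closed k).
  have le_UV : (\dim U <= \dim V)%N by apply: rank_min; apply/asboolP; exists k, V.
  have sub_kh : {subset im k <= im h}.
    by move=> _ /asboolP[v <-]; have [w ->] := kh v; apply/asboolP; exists w.
  have hu : h u \in im h by apply/asboolP; exists u.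
  by have /asboolP[v <-] := submod_dim_le VE UE sub_kh le_UV hu; exists v.
have h_im u : exists v, h u = h (h v).
  apply: (min_im (h \o h)) => v; first exact: etrans (pih _) (pih _).
  by exists (h v).
pose P := submod (image_closed h); pose j : {linear P -> E} := submod_incl _.
have j_inj : injective j by exact: val_inj.
have [hP jhP] : exists hP : {linear E -> P}, forall v, j (hP v) = h v.
  apply: factor_inj => // v.
  have hv : h v \in submod_pred (image_closed h) by apply/asboolP; exists v.
  by exists (Submod hv).
have hP_surj : surj hP.
  move=> x; have /asboolP[v vx] := submod_valP x; exists v; apply: j_inj.
  by rewrite jhP.
have hPj_inj : injective (hP \o j).
  move=> x y hPxy; apply/eqP; rewrite -subr_eq0; apply/eqP; apply: j_inj.
  have [v vE] := hP_surj (x - y); rewrite -vE jhP linear0.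
  apply: injective_on_image => //.
  have hPhv : hP (h v) = 0.
    by rewrite -jhP vE !linearB; apply/eqP; rewrite subr_eq0; apply/eqP.
  by rewrite -jhP hPhv linear0.
have [w wE] : exists w : {linear P -> P},
    forall x, (hP \o j) (w x) = (idfun : {linear P -> P}) x.
  apply: factor_inj => // x; have [v <-] := hP_surj x.
  have [u hu] := h_im v; exists (hP u); apply: j_inj.
  by rewrite -[LHS]/(j (hP (j (hP u)))) -[RHS]/(j (hP v)) !jhP hu.
pose p : {linear P -> M} := pi \o j.
have p_surj : surj p.
  by move=> m; have [v <-] := s_surj m; exists (hP v); rewrite -[LHS]/(pi (j (hP v))) jhP pih.
exists (FgMod (fin_gen_submod_free (image_closed h))), p; split=> //.
  move=> X Y g f g_surj.
  have [u gu] := free_mod_projective (f \o hP) g_surj.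
  exists (u \o (j \o w)) => x; rewrite -[LHS]/(g (u (j (w x)))) gu.
  by rewrite -[LHS]/(f ((hP \o j) (w x))) wE.
move=> L L_closed PL x; pose jL := submod_incl L_closed.
have pL_surj : surj (p \o jL).
  move=> m; have [y ym] := p_surj m; have [a [z [pa0 zL yE]]] := PL y.
  by exists (Submod (S_closed := L_closed) zL); rewrite -ym yE linearD pa0 add0r.
have [k pk] := free_mod_projective pi pL_surj.
have [v xv] := hP_surj x.
have [u hu] : exists u, h v = (j \o (jL \o k)) u.
  apply: (min_im (j \o (jL \o k))); first exact: pk.
  by move=> t; have [u ku] := hP_surj (jL (k t)); exists u; rewrite -jhP ku.
have -> : x = jL (k u) by apply: j_inj; rewrite -xv jhP hu.
exact: submod_valP.
Qed.

End FinDimAlgebra.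

Theorem lemma3p1 (F : fieldType) (Lambda : falgType F) (k : nat)
  (k_ge1 : (1 <= k)%N) (A B C : fgMod Lambda^c)
  (f : {linear A -> B}) (g : {linear B -> C}) (fg_exact : short_exact f g)
  (m1 m2 : nat) (ddellA : ddell k A = Some m1) (ddellC : ddell k C = Some m2) :
  xnat_le (ddell k B) (Some (m1 + m2 + 1)%N).
Proof.
apply: (ddell_extension (@fin_gen_kermod _ _) (@proj_cover_exists _ _) fg_exact).
  by rewrite ddellA /=.
by rewrite ddellC /=.
Qed.
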